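(* Let $\mathcal{V}\subset\mathbb{F}_q^d$ be a regular variety and let $\mathcal{E}\subseteq\mathcal{V}$ with $|\mathcal{E}|>q^{(d-1)/2}$. (1) If $k\ge2$ is even, then $\Lambda_k(\mathcal{E})\ll q^{\frac{(d-1)(k-2)}{2}}|\mathcal{E}|+\frac{|\mathcal{E}|^{k-1}}{q}$. (2) If $k\ge3$ is odd, then $\Lambda_{k-1}(\mathcal{E})\Lambda_{k+1}(\mathcal{E})\ll q^{(d-1)(k-2)}|\mathcal{E}|^2+q^{\frac{(d-1)(k-3)-2}{2}}|\mathcal{E}|^{k+1}+\frac{|\mathcal{E}|^{2k-2}}{q^2}$.
   Context: Let $\chi$ be a fixed nontrivial additive character of $\mathbb{F}_q$, and $\widehat{\mathbf{1}_\mathcal{V}}(\mathbf{m})=q^{-d}\sum_{\mathbf{x}\in\mathbb{F}_q^d}\chi(-\mathbf{m}\cdot\mathbf{x})\mathbf{1}_\mathcal{V}(\mathbf{x})$. A variety $\mathcal{V}=\{\mathbf{x}\in\mathbb{F}_q^d : F(\mathbf{x})=0\}$ ($F$ a polynomial over $\mathbb{F}_q$) is regular if $|\mathcal{V}|\asymp q^{d-1}$ and $|\widehat{\mathbf{1}_\mathcal{V}}(\mathbf{m})|\ll q^{-(d+1)/2}$ for all $\mathbf{m}\neq\mathbf{0}$. All objects depend on $q$ with $d,k$ fixed; $\asymp$ and $\ll$ hold with positive constants independent of $q$. For even $\ell=2m\ge2$, $\Lambda_\ell(\mathcal{E})=|\{(\mathbf{x}^1,\ldots,\mathbf{x}^\ell)\in\mathcal{E}^\ell:\mathbf{x}^1+\cdots+\mathbf{x}^m=\mathbf{x}^{m+1}+\cdots+\mathbf{x}^\ell\}|$.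 *)

(* Defs.v *)
From HB Require Import structures.
From mathcomp Require Import all_boot all_order all_algebra.
From mathcomp Require Import reals exp complex.
From mathcomp Require mpoly.

Set Implicit Arguments.
Unset Strict Implicit.
Unset Printing Implicit Defensive.
Import Order.TTheory GRing.Theory Num.Theory.
Local Open Scope ring_scope.
Local Open Scope complex_scope.

Definition additive_character (R : realType) (F : finFieldType)
    (chi : F -> R[i]) : Prop :=
  chi 0 = 1 /\ forall a b : F, chi (a + b) = chi a * chi b.

Definition nontrivial_character (R : realType) (F : finFieldType)
    (chi : F -> R[i]) : Prop :=
  exists a : F, chi a != 1.

Definition dotp (F : finFieldType) (d : nat) (u v : 'rV[F]_d) : F :=
  \sum_(j < d) u 0 j * v 0 j.

Definition fourier (R : realType) (F : finFieldType) (d : nat)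
    (chi : F -> R[i]) (f : 'rV[F]_d -> R[i]) (m : 'rV[F]_d) : R[i] :=
  (#|F|%:R ^+ d)^-1 * \sum_(x : 'rV[F]_d) chi (- dotp m x) * f x.

Definition indicator (R : realType) (F : finFieldType) (d : nat)
    (V : {set 'rV[F]_d}) (x : 'rV[F]_d) : R[i] := (x \in V)%:R.

Definition variety (F : finFieldType) (d : nat) (P : mpoly.mpoly d F) :
    {set 'rV[F]_d} :=
  [set x : 'rV[F]_d | mpoly.meval (fun j : 'I_d => x 0 j) P == 0].

(* The constants c1, c2, c3 are the ones implicit in |V| \asymp q^(d-1) and
   |hat 1_V(m)| << q^(-(d+1)/2). A regular variety, as a family indexed by q,
   is one that satisfies this predicate with c1, c2, c3 > 0 independent of q. *)
Definition regular (R : realType) (c1 c2 c3 : R) (F : finFieldType) (d : nat)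
    (chi : F -> R[i]) (V : {set 'rV[F]_d}) : Prop :=
  [/\ c1 * #|F|%:R `^ (d%:R - 1) <= #|V|%:R,
      #|V|%:R <= c2 * #|F|%:R `^ (d%:R - 1)
    & forall m : 'rV[F]_d, m != 0 ->
        `|fourier chi (indicator R V) m|
          <= (c3 * #|F|%:R `^ (- ((d%:R + 1) / 2)))%:C].

(* Only meaningful for even l: the first l/2 entries of the tuple t are summed
   on the left, the last l/2 on the right. *)
Definition Lambda (F : finFieldType) (d l : nat) (E : {set 'rV[F]_d}) : nat :=
  #|[set t : {ffun 'I_l -> 'rV[F]_d} |
      [forall i, t i \in E] &&
      (\sum_(i < l | (i < l./2)%N) t i == \sum_(i < l | (l./2 <= i)%N) t i)]|.

(* Main.v *)
(* Write [s m] for the modulus of the exponential sum of [E] at frequency [m].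
   By orthogonality [q^d Lambda_(2n)(E)] is the moment of order [2n] of [s].
   Letting one variable range over all of V and isolating the frequency 0, the
   Fourier decay of V gives
     Lambda_(2n+2) << |E|^(2n+1) / q + q^(d-1) Lambda_(2n).
   Starting from [Lambda_2 <= |E|] and absorbing [q^(d-1)] into [|E|^2], this
   yields the even case by induction.  The odd case is the product of two
   consecutive even bounds, where one cross term absorbs the other since
   [q^(d-1) < |E|^2]. *)
Require Import Defs.
From HB Require Import structures.
From mathcomp Require Import all_boot all_order all_algebra.
From mathcomp Require Import reals exp complex.
From mathcomp Require mpoly.
From mathcomp Require Import ring lra zify.

Set Implicit Arguments.
Unset Strict Implicit.
Unset Printing Implicit Defensive.
Import Order.TTheory GRing.Theory Num.Theory.
Import ComplexField.Normc.
Local Open Scope ring_scope.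
Local Open Scope complex_scope.

(** * Additive characters and their orthogonality *)

Lemma character_prod (R : realType) (F : finFieldType) (chi : F -> R[i])
    (I : finType) (Q : pred I) (f : I -> F) : additive_character chi ->
  chi (\sum_(i | Q i) f i) = \prod_(i | Q i) chi (f i).
Proof. by move=> [chi0 chiD]; exact: (big_morph chi chiD chi0). Qed.

(** Translation by [a] permutes the field and multiplies the nonzero product of all values of [chi]
    by [chi a ^+ #|F|], so [chi a] is a root of unity. *)
Lemma character_norm (R : realType) (F : finFieldType) (chi : F -> R[i]) a :
  additive_character chi -> `|chi a| = 1.
Proof.
move=> [chi0 chiD].
have chi_neq0 x : chi x != 0.
  apply: contra_eq_neq (chiD x (- x)) => ->.
  by rewrite subrr chi0 mul0r oner_eq0.
have prod_neq0 : \prod_x chi x != 0 by apply/prodf_neq0.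
have chi_order : chi a ^+ #|F| = 1.
  apply: (mulIf prod_neq0); rewrite mul1r [RHS](reindex_inj (addrI a)) /=.
  by under [RHS]eq_bigr do rewrite chiD; rewrite big_split prodr_const.
have q_gt0 : (0 < #|F|)%N by apply: (ltn_trans _ (card_finNzRing_gt1 F)).
apply/eqP; rewrite -(pexpr_eq1 q_gt0 (normr_ge0 _)) -normrX.
by rewrite chi_order normr1.
Qed.

Lemma characterN (R : realType) (F : finFieldType) (chi : F -> R[i]) a :
  additive_character chi -> chi (- a) = (chi a)^*%R.
Proof.
move=> chi_char; have [chi0 chiD] := chi_char.
have chi_neq0 : chi a != 0 by rewrite -normr_eq0 character_norm ?oner_eq0.
apply: (mulfI chi_neq0).
by rewrite -chiD subrr chi0 -normCK character_norm ?expr1n.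
Qed.

Lemma dotpDl (F : finFieldType) d (u v w : 'rV[F]_d) :
  dotp (u + v) w = dotp u w + dotp v w.
Proof. by rewrite -big_split; apply: eq_bigr => j _; rewrite mxE mulrDl. Qed.

Lemma dotpBr (F : finFieldType) d (u v w : 'rV[F]_d) :
  dotp u (v - w) = dotp u v - dotp u w.
Proof.
rewrite -sumrN -big_split; apply: eq_bigr => j _.
by rewrite !mxE mulrDr mulrN.
Qed.

Lemma dotp_sumr (F : finFieldType) d (u : 'rV[F]_d) (I : finType) (Q : pred I)
    (f : I -> 'rV[F]_d) :
  dotp u (\sum_(i | Q i) f i) = \sum_(i | Q i) dotp u (f i).
Proof.
rewrite /dotp exchange_big; apply: eq_bigr => j _ /=.
by rewrite summxE mulr_sumr.
Qed.

(** For [y != 0] some [m0] satisfies [chi (dotp m0 y) != 1]. Translating the summation variable by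
    [m0] multiplies the sum by this value, so the sum vanishes. *)
Lemma sum_character (R : realType) (F : finFieldType) d (chi : F -> R[i])
    (y : 'rV[F]_d) : additive_character chi -> nontrivial_character chi ->
  \sum_(m : 'rV[F]_d) chi (dotp m y) = (#|F| ^ d)%:R * (y == 0)%:R.
Proof.
move=> [chi0 chiD] [a chi_a]; have [->|y_neq0] := eqVneq y 0.
  rewrite mulr1 (eq_bigr (fun=> 1)) => [|m _].
    by rewrite sumr_const card_mx mul1n.
  by rewrite /dotp big1 // => j _; rewrite mxE mulr0.
rewrite mulr0; have [j yj] : exists j, y 0 j != 0 by apply/rV0Pn.
pose m0 : 'rV[F]_d := (a / y 0 j) *: delta_mx 0 j.
have m0y : dotp m0 y = a.
  rewrite /dotp (bigD1 j) //= big1 => [|i i_neqj].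
    by rewrite !mxE !eqxx mulr1 divfK // addr0.
  by rewrite !mxE (negPf i_neqj) andbF mulr0 mul0r.
set S := \sum_m _; have SE : chi a * S = S.
  rewrite [RHS](reindex_inj (addrI m0)) mulr_sumr.
  by apply: eq_bigr => m _; rewrite dotpDl chiD m0y.
apply/eqP; have : (chi a - 1) * S == 0 by rewrite mulrBl SE mul1r subrr.
by rewrite mulf_eq0 subr_eq0 (negPf chi_a).
Qed.

(** * Solution counts, moments of exponential sums and the recursive inequality *)

(** Generalizes the set counted by [Lambda]: each variable has its own set, so that one of them can
    range over the variety while the others stay in [E]. *)
Definition solutions (F : finFieldType) (d l h : nat)
    (A : 'I_l -> {set 'rV[F]_d}) : {set {ffun 'I_l -> 'rV[F]_d}} :=
  [set t : {ffun 'I_l -> 'rV[F]_d} | [forall i, t i \in A i] &&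
    (\sum_(i < l | (i < h)%N) t i == \sum_(i < l | (h <= i)%N) t i)].

(** This is q^d times the Fourier coefficient of the indicator of [A] at [- m]. *)
Definition expsum (R : realType) (F : finFieldType) (d : nat)
    (chi : F -> R[i]) (A : {set 'rV[F]_d}) (m : 'rV[F]_d) : R[i] :=
  \sum_(x in A) chi (dotp m x).

(** Orthogonality in [m] detects the equation. For fixed [m] the sum over tuples factors into one
    sum per variable; variables on the right of the equation enter with a minus sign, hence the
    conjugates. *)
Lemma card_solutions (R : realType) (F : finFieldType) (d l h : nat)
    (chi : F -> R[i]) (A : 'I_l -> {set 'rV[F]_d}) :
  additive_character chi -> nontrivial_character chi ->
  (#|F| ^ d)%:R * #|solutions h A|%:R =
  \sum_(m : 'rV[F]_d) \prod_(i < l)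
    (if (i < h)%N then expsum chi (A i) m else (expsum chi (A i) m)^*%R).
Proof.
move=> chi_char chi_nt; have [_ chiD] := chi_char.
pose phi (t : {ffun 'I_l -> 'rV[F]_d}) :=
  \sum_(i < l | (i < h)%N) t i - \sum_(i < l | (h <= i)%N) t i.
have prodE m (t : {ffun 'I_l -> 'rV[F]_d}) : chi (dotp m (phi t)) =
    \prod_(i < l) (if (i < h)%N then chi (dotp m (t i))
                   else (chi (dotp m (t i)))^*%R).
  rewrite dotpBr chiD characterN // !dotp_sumr !character_prod // rmorph_prod.
  rewrite [RHS](bigID (fun i : 'I_l => (i < h)%N)) /=; congr (_ * _).
    by apply: eq_bigr => i ->.
  by apply: eq_big => [i|i]; rewrite leqNgt // => /negPf ->.
transitivity (\sum_(m : 'rV[F]_d) \sum_(t in family A) chi (dotp m (phi t))).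
  rewrite exchange_big /=.
  rewrite (eq_bigr (fun t => (#|F| ^ d)%:R * (phi t == 0)%:R)) => [|t _].
    rewrite -mulr_sumr -natr_sum; congr (_ * _%:R).
    transitivity (\sum_(t in family A | phi t == 0%R) 1)%N.
      rewrite sum1_card; apply: eq_card => t.
      by rewrite [LHS]inE [RHS]unfold_in /= subr_eq0.
    by rewrite big_mkcondr; apply: eq_bigr => t _; case: (phi t == 0).
  exact: sum_character.
apply: eq_bigr => m _.
under [LHS]eq_bigr do rewrite prodE.
rewrite -(bigA_distr_big_dep (fun i x => x \in A i)
  (fun i x => if (i < h)%N then chi (dotp m x) else (chi (dotp m x))^*%R)).
by apply: eq_bigr => i _; case: ifP => _ //; rewrite rmorph_sum.
Qed.

Lemma LambdaE (F : finFieldType) (d l : nat) (E : {set 'rV[F]_d}) :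
  Lambda l E = #|solutions l./2 (fun _ : 'I_l => E)|.
Proof. by []. Qed.

Lemma expsum0 (R : realType) (F : finFieldType) (d : nat)
    (chi : F -> R[i]) (A : {set 'rV[F]_d}) : additive_character chi ->
  expsum chi A 0 = #|A|%:R.
Proof.
move=> [chi0 _]; rewrite -sumr_const; apply: eq_bigr => x _.
by rewrite /dotp big1 ?chi0 // => j _; rewrite mxE mul0r.
Qed.

Lemma normc_ge0 (R : rcfType) (z : R[i]) : 0 <= normc z.
Proof. by case: z => a b; rewrite sqrtr_ge0. Qed.

Lemma normr_normc (R : rcfType) (z : R[i]) : `|z| = (normc z)%:C.
Proof. by []. Qed.

Lemma normc_expsum0 (R : realType) (F : finFieldType) (d : nat)
    (chi : F -> R[i]) (A : {set 'rV[F]_d}) : additive_character chi ->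
  normc (expsum chi A 0) = #|A|%:R.
Proof.
move=> chi_char; apply: (@complexI R).
by rewrite -normr_normc expsum0 // normr_nat rmorph_nat.
Qed.

(** The [n] exponential sums and their [n] conjugates pair up into squared moduli. *)
Lemma Lambda_moment (R : realType) (F : finFieldType) (d n : nat)
    (chi : F -> R[i]) (E : {set 'rV[F]_d}) :
  additive_character chi -> nontrivial_character chi ->
  (#|F| ^ d)%:R * (Lambda n.*2 E)%:R =
  \sum_(m : 'rV[F]_d) normc (expsum chi E m) ^+ n.*2.
Proof.
move=> chi_char chi_nt; apply: (@complexI R).
rewrite rmorphM /= !rmorph_nat LambdaE (card_solutions _ _ chi_char chi_nt).
rewrite rmorph_sum /=; apply: eq_bigr => m _.
rewrite rmorphXn /= -normr_normc doubleK -addnn big_split_ord /=.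
rewrite (eq_bigr (fun=> expsum chi E m)) => [|i _]; last by rewrite ltn_ord.
rewrite [X in _ * X](eq_bigr (fun=> (expsum chi E m)^*%R)) => [|i _].
  by rewrite !prodr_const card_ord -exprMn -normCK -exprM mul2n addnn.
by rewrite ltnNge leq_addr.
Qed.

(* Only the last variable is enlarged from [E] to [V]: the nonzero frequencies
   then carry one factor [expsum chi V m], bounded by [B], and
   [2 B s^(2n+1) <= s^(2n+2) + B^2 s^(2n)] splits the odd moment into the two
   neighbouring even ones. *)
Lemma Lambda_step (R : realType) (F : finFieldType) (d n : nat)
    (chi : F -> R[i]) (E V : {set 'rV[F]_d}) (B : R) :
  additive_character chi -> nontrivial_character chi -> E \subset V ->
  (forall m : 'rV[F]_d, m != 0 -> normc (expsum chi V m) <= B) ->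
  (Lambda n.+1.*2 E)%:R <=
    2 * #|V|%:R / (#|F| ^ d)%:R * #|E|%:R ^+ n.*2.+1
    + B ^+ 2 * (Lambda n.*2 E)%:R.
Proof.
move=> chi_char chi_nt subEV V_le.
pose A (i : 'I_n.+1.*2) := if i == ord_max then V else E.
pose s (m : 'rV[F]_d) := normc (expsum chi E m).
have s_ge0 m : 0 <= s m by exact: normc_ge0.
have qd_gt0 : 0 < (#|F| ^ d)%:R :> R.
  by rewrite ltr0n expn_gt0 (ltn_trans _ (card_finNzRing_gt1 F)).
have LambdaA : (Lambda n.+1.*2 E <= #|solutions n.+1 A|)%N.
  rewrite LambdaE doubleK; apply/subset_leq_card/subsetP => t.
  rewrite !inE => /andP[/forallP tE ->]; rewrite andbT; apply/forallP => i.
  by rewrite /A; case: eqP => // _; apply: (subsetP subEV).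
have sumA : (#|F| ^ d)%:R * #|solutions n.+1 A|%:R <=
    \sum_(m : 'rV[F]_d) s m ^+ n.*2.+1 * normc (expsum chi V m).
  (* In [R[i]] the left side is its own norm, so the triangle inequality applies to the exact
     formula; conjugation leaves the norm of each factor unchanged. *)
  rewrite -lecR rmorphM /= !rmorph_nat.
  rewrite -[X in X <= _]ger0_norm ?mulr_ge0 //.
  rewrite (card_solutions _ _ chi_char chi_nt).
  rewrite (le_trans (ler_norm_sum _ _ _)) //.
  rewrite rmorph_sum ler_sum // => m _.
  rewrite normr_prod big_ord_recr /= rmorphM rmorphXn /=.
  rewrite (eq_bigr (fun=> (s m)%:C)) => [|i _].
    rewrite prodr_const card_ord /A eqxx.
    by case: ifP => _; rewrite ?norm_conjC normr_normc lexx.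
  rewrite [A _]ifN; first by case: ifP => _; rewrite ?norm_conjC normr_normc.
  by rewrite -val_eqE /= ltn_eqF.
have le_term m : m != 0 -> s m ^+ n.*2.+1 * normc (expsum chi V m) <=
    2^-1 * (s m ^+ n.+1.*2 + B ^+ 2 * s m ^+ n.*2).
  move=> m_neq0; apply: (le_trans (ler_wpM2l _ (V_le m m_neq0))).
    by rewrite exprn_ge0.
  rewrite -subr_ge0 doubleS ![s m ^+ _.+1]exprS.
  have -> : 2^-1 * (s m * (s m * s m ^+ n.*2) + B ^+ 2 * s m ^+ n.*2)
     - s m * s m ^+ n.*2 * B = 2^-1 * (s m ^+ n.*2 * (s m - B) ^+ 2) by field.
  by rewrite mulr_ge0 ?invr_ge0 // mulr_ge0 ?sqr_ge0 // exprn_ge0.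
have sum_le : \sum_(m : 'rV[F]_d) s m ^+ n.*2.+1 * normc (expsum chi V m) <=
    #|E|%:R ^+ n.*2.+1 * #|V|%:R + 2^-1 * ((#|F| ^ d)%:R *
      ((Lambda n.+1.*2 E)%:R + B ^+ 2 * (Lambda n.*2 E)%:R)).
  (* Frequency 0 contributes exactly |E|^(2n+1) |V|. The others are bounded by [le_term], and a
     nonnegative term at 0 is added to complete the two moments. *)
  rewrite mulrDr [_ * (B ^+ 2 * _)]mulrCA !(Lambda_moment _ _ chi_char chi_nt).
  rewrite mulr_sumr -big_split mulr_sumr /= (bigD1 0) //= /s !normc_expsum0 //.
  rewrite lerD2l [leRHS](bigD1 0) //= -[leLHS]add0r lerD ?ler_sum //.
  rewrite mulr_ge0 ?invr_ge0 // addr_ge0 ?exprn_ge0 ?normc_ge0 //.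
  by rewrite mulr_ge0 ?sqr_ge0 // exprn_ge0 ?normc_ge0.
have {LambdaA sumA sum_le} Lambda_le : (#|F| ^ d)%:R * (Lambda n.+1.*2 E)%:R <=
    #|E|%:R ^+ n.*2.+1 * #|V|%:R + 2^-1 * ((#|F| ^ d)%:R *
      ((Lambda n.+1.*2 E)%:R + B ^+ 2 * (Lambda n.*2 E)%:R)) :> R.
  apply: le_trans sum_le; apply: le_trans sumA.
  by rewrite ler_pM2l // ler_nat.
(* Moving half of the [Lambda n.+1.*2 E] term to the left and doubling produces the factor 2 of the
   conclusion. *)
rewrite -(ler_pM2l qd_gt0).
have -> : (#|F| ^ d)%:R * (2 * #|V|%:R / (#|F| ^ d)%:R * #|E|%:R ^+ n.*2.+1 +
     B ^+ 2 * (Lambda n.*2 E)%:R) = 2 * (#|E|%:R ^+ n.*2.+1 * #|V|%:R)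
    + (#|F| ^ d)%:R * (B ^+ 2 * (Lambda n.*2 E)%:R) :> R.
  by field; rewrite gt_eqF.
lra.
Qed.

(** * Inputs of the induction: the count of order two and the Fourier decay *)

(** The equation makes both entries equal, so the first one determines the tuple. *)
Lemma Lambda2_le (F : finFieldType) (d : nat) (E : {set 'rV[F]_d}) :
  (Lambda 2 E <= #|E|)%N.
Proof.
pose f (t : {ffun 'I_2 -> 'rV[F]_d}) := t ord0.
rewrite LambdaE -(@card_in_imset _ _ f) => [|t u].
  apply/subset_leq_card/subsetP => _ /imsetP[t + ->].
  by rewrite inE => /andP[/forallP tE _]; exact: tE.
have sumE (v : {ffun 'I_2 -> 'rV[F]_d}) : v \in solutions 1 (fun=> E) ->
    v ord0 = v ord_max.
  rewrite inE => /andP[_ /eqP].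
  rewrite big_mkcond [RHS]big_mkcond !big_ord_recl !big_ord0 /= !add0r !addr0.
  by move=> ->; congr (v _); apply: val_inj.
move=> /sumE t_eq /sumE u_eq tu0; apply/ffunP => i.
have [->//|->] : i = ord0 \/ i = ord_max.
  by case: i => [[|[|//]] lt_i]; [left|right]; apply: val_inj.
by rewrite -t_eq -u_eq.
Qed.

Lemma natr_card_gt0 (R : realType) (F : finFieldType) : 0 < #|F|%:R :> R.
Proof. by rewrite ltr0n (ltn_trans _ (card_finNzRing_gt1 F)). Qed.

Lemma powRBnat1 (R : realType) (q : R) (d : nat) : 0 < q ->
  q `^ (d%:R - 1) = q ^+ d / q.
Proof.
move=> q_gt0; rewrite powRB ?(gt_eqF q_gt0) ?implybT //.
by rewrite powR_mulrn ?powRr1 // ltW.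
Qed.

(** The missing normalization q^d turns the decay q^(-(d+1)/2) into q^((d-1)/2), whose square is the
    factor q^(d-1) of the recursion. *)
Lemma regular_expsum (R : realType) (c1 c2 c3 : R) (F : finFieldType)
    (d : nat) (chi : F -> R[i]) (V : {set 'rV[F]_d}) (m : 'rV[F]_d) :
  regular c1 c2 c3 chi V -> m != 0 ->
  normc (expsum chi V m) <= c3 * #|F|%:R `^ ((d%:R - 1) / 2).
Proof.
move=> [_ _ fourierV] m_neq0; have q_gt0 := natr_card_gt0 R F.
have expsumE : expsum chi V m =
    (#|F|%:R ^+ d)%:C * fourier chi (indicator R V) (- m).
  rewrite /fourier rmorphXn /= rmorph_nat mulVKf; last first.
    by rewrite expf_neq0 // pnatr_eq0 -lt0n -(ltr0n R).
  rewrite /expsum big_mkcond; apply: eq_bigr => x _.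
  have -> : - dotp (- m) x = dotp m x.
    by rewrite /dotp -sumrN; apply: eq_bigr => j _; rewrite mxE mulNr opprK.
  by rewrite /indicator; case: (x \in V); rewrite ?mulr1 ?mulr0.
rewrite expsumE -lecR -normr_normc normrM ger0_norm; last first.
  by rewrite ler0c exprn_ge0 // ltW.
have -> : (d%:R - 1) / 2 = d%:R + - ((d%:R + 1) / 2) :> R by field.
rewrite powRD ?(gt_eqF q_gt0) ?implybT // powR_mulrn ?(ltW q_gt0) // mulrCA.
rewrite [leRHS]rmorphM /= ler_wpM2l //; first by rewrite ler0c exprn_ge0 // ltW.
by apply: fourierV; rewrite oppr_eq0.
Qed.

(** * Even orders by induction *)

(** One recursion step adds [2 * c2], from frequency 0, and multiplies by [c3 ^+ 2], from the decay.
    The result is independent of the field. *)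
Fixpoint energy_const (R : realType) (c2 c3 : R) (n : nat) : R :=
  if n is n'.+1 then 2 * c2 + c3 ^+ 2 * energy_const c2 c3 n' else 1.

Lemma energy_const_gt0 (R : realType) (c2 c3 : R) n : 0 < c2 ->
  0 < energy_const c2 c3 n.
Proof.
move=> c2_gt0; elim: n => [|n IHn] //=.
by rewrite ltr_wpDr ?mulr_gt0 // mulr_ge0 ?sqr_ge0 // ltW.
Qed.

Lemma Lambda_even_le (R : realType) (d n : nat) (c1 c2 c3 : R)
    (F : finFieldType) (chi : F -> R[i]) (E V : {set 'rV[F]_d}) :
  let q : R := #|F|%:R in
  let e : R := #|E|%:R in
  let Q : R := q `^ (d%:R - 1) in
  0 < c2 -> additive_character chi -> nontrivial_character chi ->
  regular c1 c2 c3 chi V -> E \subset V -> Q <= e ^+ 2 ->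
  (Lambda n.+1.*2 E)%:R <=
    energy_const c2 c3 n * (Q ^+ n * e + e ^+ n.*2.+1 / q).
Proof.
move=> q e Q c2_gt0 chi_char chi_nt regV subEV leQe.
have q_gt0 : 0 < q := natr_card_gt0 R F.
have e_ge0 : 0 <= e by [].
have Q_ge0 : 0 <= Q := powR_ge0 _ _.
elim: n => [|n IHn] /=.
  rewrite mul1r expr0 mul1r expr1 ler_wpDr ?divr_ge0 ?(ltW q_gt0) //.
  by rewrite ler_nat Lambda2_le.
have V_le m : m != 0 -> normc (expsum chi V m) <= c3 * q `^ ((d%:R - 1) / 2).
  exact: regular_expsum regV.
have := Lambda_step n.+1 chi_char chi_nt subEV V_le.
rewrite exprMn -[_ `^ _ ^+ 2]powR_mulrn ?powR_ge0 //.
rewrite -powRrM divfK ?pnatr_eq0 //.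
rewrite -/Q -/e => /le_trans; apply.
set C := energy_const _ _ _ in IHn *.
have C_ge0 : 0 <= C := ltW (energy_const_gt0 _ _ c2_gt0).
have cardV : #|V|%:R / (#|F| ^ d)%:R <= c2 / q.
  have [_ V_card _] := regV; rewrite ler_pdivrMr ?natrX ?exprn_gt0 //.
  by rewrite mulrAC -mulrA -powRBnat1.
have -> : e ^+ n.+1.*2.+1 = e ^+ 2 * e ^+ n.*2.+1 by rewrite -exprD.
set x := e ^+ n.*2.+1 in IHn *.
have x_ge0 : 0 <= x by exact: exprn_ge0.
rewrite [Q ^+ _]exprS.
have xq_ge0 : 0 <= x / q by rewrite divr_ge0 // ltW.
have Qn_ge0 : 0 <= Q * Q ^+ n * e by rewrite !mulr_ge0 ?exprn_ge0.
have le1 : 2 * #|V|%:R / (#|F| ^ d)%:R * (e ^+ 2 * x) <=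
    2 * c2 * (e ^+ 2 * x / q).
  have -> : 2 * c2 * (e ^+ 2 * x / q) = 2 * (c2 / q) * (e ^+ 2 * x).
    by field; rewrite gt_eqF.
  by rewrite -[2 * _ / _]mulrA ler_wpM2r ?mulr_ge0 ?sqr_ge0 // ler_wpM2l.
(* [Q] times the induction hypothesis: the first term gains a power of [Q], and [Q <= e ^+ 2] raises
   the second to the next power of [e]. *)
have le2 : c3 ^+ 2 * Q * (Lambda n.+1.*2 E)%:R <=
    c3 ^+ 2 * C * (Q * Q ^+ n * e + e ^+ 2 * x / q).
  rewrite -!(mulrA (c3 ^+ 2)) ler_wpM2l ?sqr_ge0 //.
  apply: (le_trans (ler_wpM2l Q_ge0 IHn)); rewrite mulrCA ler_wpM2l //.
  by rewrite mulrDr !mulrA lerD2l -!(mulrA _ x) ler_wpM2r.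
apply: (le_trans (lerD le1 le2)); rewrite [leRHS]mulrDl lerD2r.
by rewrite ler_wpM2l ?mulr_ge0 // ?(ltW c2_gt0) // lerDr.
Qed.

(** * Even bound, and odd bound as a product of consecutive even ones *)

Theorem theorem4p6 (R : realType) (d k : nat) (c1 c2 c3 : R)
    (hc1 : 0 < c1) (hc2 : 0 < c2) (hc3 : 0 < c3) :
  exists2 C : R, 0 < C &
    forall (F : finFieldType) (chi : F -> R[i]) (P : mpoly.mpoly d F)
        (E : {set 'rV[F]_d}),
      let q : R := #|F|%:R in
      let e : R := #|E|%:R in
      let D : R := d%:R - 1 in
      let K : R := k%:R in
      additive_character chi -> nontrivial_character chi ->
      regular c1 c2 c3 chi (variety P) ->
      E \subset variety P ->
      q `^ (D / 2) < e ->
      ((2 <= k)%N -> ~~ odd k ->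
        (Lambda k E)%:R <= C * (q `^ (D * (K - 2) / 2) * e + e ^+ (k - 1) / q))
      /\
      ((3 <= k)%N -> odd k ->
        (Lambda (k - 1) E)%:R * (Lambda (k + 1) E)%:R <=
          C * (q `^ (D * (K - 2)) * e ^+ 2
               + q `^ ((D * (K - 3) - 2) / 2) * e ^+ (k + 1)
               + e ^+ (2 * k - 2) / q ^+ 2)).
Proof.
(* Thus k = 2n+2 in the even case and k = 2n+3 in the odd case. *)
pose n := k./2.-1; pose C := energy_const c2 c3.
have C_gt0 m : 0 < C m by exact: energy_const_gt0.
(* The first summand serves the even case. In the odd case the bounds of orders 2n+2 and 2n+4 are
   multiplied, and the 2 pays for merging the cross terms. *)
exists (C n + 2 * (C n * C n.+1)).
  by rewrite addr_gt0 ?mulr_gt0.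
move=> F chi P E q e D K chi_char chi_nt regV subEV lt_e.
pose Q := q `^ D.
have q_gt0 : 0 < q := natr_card_gt0 R F.
have Q_ge0 : 0 <= Q := powR_ge0 _ _.
have e_ge0 : 0 <= e by [].
have leQe : Q <= e ^+ 2.
  have -> : Q = (q `^ (D / 2)) ^+ 2.
    by rewrite -powR_mulrn ?powR_ge0 // -powRrM divfK ?pnatr_eq0.
  by rewrite lerXn2r ?nnegrE ?powR_ge0 // ltW.
have powQ m : q `^ (D * m%:R) = Q ^+ m by rewrite powRrM powR_mulrn.
have Lambda_le m := Lambda_even_le m hc2 chi_char chi_nt regV subEV leQe.
split=> [k_ge2 k_even | k_ge3 k_odd].
  have kE : k = n.+1.*2 by rewrite /n; lia.
  have -> : D * (K - 2) / 2 = D * n%:R.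
    by rewrite /K kE -addnn natrD -natr1; field.
  rewrite powQ {1 2}kE (_ : n.+1.*2 - 1 = n.*2.+1)%N; last lia.
  apply: (le_trans (Lambda_le n)); rewrite ler_wpM2r //.
    by rewrite addr_ge0 ?mulr_ge0 ?exprn_ge0 ?invr_ge0 // ltW.
  by rewrite lerDl !mulr_ge0 // ltW.
have kE : k = n.+1.*2.+1 by rewrite /n; lia.
have KE : K = n%:R * 2 + 3.
  by rewrite /K kE (_ : n.+1.*2.+1 = n * 2 + 3)%N ?natrD ?natrM //; lia.
have -> : D * (K - 2) = D * n.*2.+1%:R.
  by rewrite KE -[n.*2.+1]addn1 -muln2 natrD natrM; ring.
have -> : (D * (K - 3) - 2) / 2 = D * n%:R - 1 by rewrite KE; field.
rewrite powRB ?(gt_eqF q_gt0) ?implybT // !powQ powRr1 ?(ltW q_gt0) //.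
have k_pred : (k - 1 = n.+1.*2)%N by lia.
have k_succ : (k + 1 = n.+2.*2)%N by lia.
have k_double : (2 * k - 2 = n.*2.+1 + n.*2.+1 + 2)%N by lia.
rewrite k_pred k_succ k_double.
apply: (le_trans (ler_pM _ _ (Lambda_le n) (Lambda_le n.+1))) => //.
rewrite -/q -/e -/D -/Q -!/(C _).
have -> : e ^+ n.+2.*2 = e ^+ n.*2.+1 * e * e ^+ 2.
  by rewrite -exprSr -exprD; congr (_ ^+ _); lia.
have -> : e ^+ n.+1.*2.+1 = e ^+ n.*2.+1 * e ^+ 2.
  by rewrite -exprD; congr (_ ^+ _); lia.
have -> : Q ^+ n.*2.+1 = Q * Q ^+ n * Q ^+ n by rewrite -exprS -exprD -addnn.
rewrite !exprD [Q ^+ n.+1]exprS; set x := e ^+ n.*2.+1; set y := Q ^+ n.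
have x_ge0 : 0 <= x by exact: exprn_ge0.
have y_ge0 : 0 <= y by exact: exprn_ge0.
(* The two cross terms of the product differ by exchanging [Q] and [e ^+ 2]; the one with [e ^+ 2]
   dominates and is the middle term of [T]. *)
have cross : Q * (y * x * e / q) <= e ^+ 2 * (y * x * e / q).
  by rewrite ler_wpM2r // divr_ge0 ?mulr_ge0 // ltW.
pose T := Q * y * y * e ^+ 2 + y / q * (x * e * e ^+ 2)
  + x * x * e ^+ 2 / q ^+ 2.
rewrite -/T.
have T1 : 0 <= Q * y * y * e ^+ 2 by rewrite !mulr_ge0 ?sqr_ge0.
have T2 : 0 <= x * x * e ^+ 2 / q ^+ 2 by rewrite divr_ge0 ?mulr_ge0 ?sqr_ge0.
have T3 : 0 <= e ^+ 2 * (y * x * e / q).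
  by rewrite mulr_ge0 ?sqr_ge0 // divr_ge0 ?mulr_ge0 // ltW.
have TE : y / q * (x * e * e ^+ 2) = e ^+ 2 * (y * x * e / q).
  by field; rewrite gt_eqF.
have -> : C n * (y * e + x / q) * (C n.+1 * (Q * y * e + x * e ^+ 2 / q)) =
   (C n * C n.+1) * (Q * y * y * e ^+ 2 + e ^+ 2 * (y * x * e / q)
      + Q * (y * x * e / q) + x * x * e ^+ 2 / q ^+ 2).
  by field; rewrite gt_eqF.
have T_ge0 : 0 <= T by rewrite /T TE; lra.
apply: (@le_trans _ _ (C n * C n.+1 * (2 * T))).
  by rewrite ler_wpM2l ?mulr_ge0 ?(ltW (C_gt0 _)) // /T TE; lra.
rewrite -subr_ge0 (_ : _ - _ = C n * T); last by ring.
by rewrite mulr_ge0 // ltW.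
Qed.
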